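(* Let $n>1$ be an integer. The set $\{N\in\mathcal{G}_n : \mathbb{F}_n/N \text{ is periodic (every element has finite order)}\}$ is $\mathbf{\Pi}^0_2$-complete.
   Context: $\mathbb{F}_n$ is the free group on $\gamma_1,\dots,\gamma_n$. $\mathcal{G}_n$ denotes the set of normal subgroups $N\trianglelefteq\mathbb{F}_n$, viewed as a subset of $\{0,1\}^{\mathbb{F}_n}$ (identifying a subset with its indicator function) with the subspace topology of the product of discrete topologies; it is a compact zero-dimensional Polish space. The Borel classes are: $\mathbf{\Sigma}^0_1$ = open sets, $\mathbf{\Pi}^0_\alpha$ = complements of $\mathbf{\Sigma}^0_\alpha$ sets, $\mathbf{\Sigma}^0_\alpha$ ($\alpha>1$) = countable unions of sets in $\bigcup_{\beta<\alpha}\mathbf{\Pi}^0_\beta$. For $\mathbf{\Gamma}$ one of $\mathbf{\Sigma}^0_\alpha,\mathbf{\Pi}^0_\alpha$, a set $A\subseteq X$ is $\mathbf{\Gamma}$-complete if $A\in\mathbf{\Gamma}$ and for every zero-dimensional Polish space $Y$ and every $B\subseteq Y$ in $\mathbf{\Gamma}$ there is a continuous $f:Y\to X$ with $f^{-1}[A]=B$. *)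

(* Defs.v *)
From Stdlib Require Import Reals List Bool Arith Lia.
Import ListNotations.
Open Scope R_scope.

(* A letter (i, b): generator gamma_i if b = false, its inverse if b = true. *)
Definition letter := (nat * bool)%type.
Definition inv_letter (a : letter) : letter := (fst a, negb (snd a)).
Definition cancels (a b : letter) : bool :=
  Nat.eqb (fst a) (fst b) && xorb (snd a) (snd b).

Fixpoint reduce (w : list letter) : list letter :=
  match w with
  | [] => []
  | x :: w' =>
      match reduce w' with
      | [] => [x]
      | y :: r => if cancels x y then r else x :: y :: r
      end
  end.

Fixpoint reducedb (w : list letter) : bool :=
  match w with
  | x :: ((y :: _) as t) => negb (cancels x y) && reducedb t
  | _ => true
  end.

Definition bounded (n : nat) (w : list letter) : bool :=
  forallb (fun a => Nat.ltb (fst a) n) w.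

Definition wf (n : nat) (w : list letter) : bool := reducedb w && bounded n w.

Definition Fn (n : nat) : Type := { w : list letter | wf n w = true }.

Lemma reducedb_tail x w : reducedb (x :: w) = true -> reducedb w = true.
Proof. destruct w as [|y w]; simpl; auto. intro H; apply andb_true_iff in H; tauto. Qed.

Lemma reducedb_reduce w : reducedb (reduce w) = true.
Proof.
  induction w as [|x w IH]; simpl; auto.
  destruct (reduce w) as [|y r] eqn:E; simpl; auto.
  destruct (cancels x y) eqn:C.
  - exact (reducedb_tail y r IH).
  - change (negb (cancels x y) && reducedb (y :: r) = true).
    rewrite C, IH; reflexivity.
Qed.

Lemma bounded_reduce n w : bounded n w = true -> bounded n (reduce w) = true.
Proof.
  induction w as [|x w IH]; simpl; auto.
  intro H; apply andb_true_iff in H; destruct H as [Hx Hw].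
  specialize (IH Hw).
  destruct (reduce w) as [|y r]; simpl in *.
  - rewrite Hx; reflexivity.
  - apply andb_true_iff in IH; destruct IH as [Hy Hr].
    destruct (cancels x y); simpl; auto.
    rewrite Hx, Hy, Hr; reflexivity.
Qed.

Lemma wf_reduce n w : bounded n w = true -> wf n (reduce w) = true.
Proof. intro H; unfold wf; rewrite reducedb_reduce, bounded_reduce; auto. Qed.

Lemma bounded_app n u v :
  bounded n u = true -> bounded n v = true -> bounded n (u ++ v) = true.
Proof. intros Hu Hv; unfold bounded in *; rewrite forallb_app; apply andb_true_intro; split; assumption. Qed.

Lemma bounded_wf n w : wf n w = true -> bounded n w = true.
Proof. unfold wf; intro H; apply andb_true_iff in H; tauto. Qed.

Lemma bounded_inv n w :
  bounded n w = true -> bounded n (rev (map inv_letter w)) = true.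
Proof.
  unfold bounded; intro H; rewrite forallb_forall in *.
  intros a Ha; apply in_rev in Ha; apply in_map_iff in Ha.
  destruct Ha as [b [<- Hb]]; simpl; exact (H b Hb).
Qed.

Definition fn_one (n : nat) : Fn n := exist _ [] eq_refl.

Definition fn_mul (n : nat) (g h : Fn n) : Fn n :=
  exist _ (reduce (proj1_sig g ++ proj1_sig h))
    (wf_reduce n _ (bounded_app n _ _ (bounded_wf n _ (proj2_sig g))
                                      (bounded_wf n _ (proj2_sig h)))).

Definition fn_inv (n : nat) (g : Fn n) : Fn n :=
  exist _ (reduce (rev (map inv_letter (proj1_sig g))))
    (wf_reduce n _ (bounded_inv n _ (bounded_wf n _ (proj2_sig g)))).

Fixpoint fn_pow (n : nat) (g : Fn n) (k : nat) : Fn n :=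
  match k with
  | O => fn_one n
  | S k' => fn_mul n g (fn_pow n g k')
  end.

Definition is_normal_subgroup (n : nat) (N : Fn n -> bool) : Prop :=
  N (fn_one n) = true /\
  (forall g h, N g = true -> N h = true -> N (fn_mul n g h) = true) /\
  (forall g, N g = true -> N (fn_inv n g) = true) /\
  (forall g h, N h = true -> N (fn_mul n (fn_mul n g h) (fn_inv n g)) = true).

Definition Gn (n : nat) : Type := { N : Fn n -> bool | is_normal_subgroup n N }.

Definition prod_open {I : Type} (U : (I -> bool) -> Prop) : Prop :=
  forall x, U x -> exists F : list I,
    forall x', (forall i, In i F -> x' i = x i) -> U x'.

Definition Gn_open (n : nat) (U : Gn n -> Prop) : Prop :=
  exists V : (Fn n -> bool) -> Prop,
    prod_open V /\ forall N : Gn n, U N <-> V (proj1_sig N).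

Definition closed_in {X : Type} (opn : (X -> Prop) -> Prop) (A : X -> Prop) : Prop :=
  opn (fun x => ~ A x).

Definition Sigma02 {X : Type} (opn : (X -> Prop) -> Prop) (A : X -> Prop) : Prop :=
  exists F : nat -> X -> Prop,
    (forall k, closed_in opn (F k)) /\ (forall x, A x <-> exists k, F k x).

Definition Pi02 {X : Type} (opn : (X -> Prop) -> Prop) (A : X -> Prop) : Prop :=
  Sigma02 opn (fun x => ~ A x).

Definition continuous {X Y : Type} (opnX : (X -> Prop) -> Prop)
  (opnY : (Y -> Prop) -> Prop) (f : X -> Y) : Prop :=
  forall U, opnY U -> opnX (fun x => U (f x)).

Definition is_metric {Y : Type} (d : Y -> Y -> R) : Prop :=
  (forall x y, 0 <= d x y) /\
  (forall x y, d x y = 0 <-> x = y) /\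
  (forall x y, d x y = d y x) /\
  (forall x y z, d x z <= d x y + d y z).

Definition metric_open {Y : Type} (d : Y -> Y -> R) (U : Y -> Prop) : Prop :=
  forall x, U x -> exists eps, 0 < eps /\ forall y, d x y < eps -> U y.

Definition metric_complete {Y : Type} (d : Y -> Y -> R) : Prop :=
  forall u : nat -> Y,
    (forall eps, 0 < eps -> exists N, forall m k, (N <= m)%nat -> (N <= k)%nat ->
        d (u m) (u k) < eps) ->
    exists l, forall eps, 0 < eps -> exists N, forall m, (N <= m)%nat -> d (u m) l < eps.

(* Countable dense subset (indexed by nat with option to allow Y empty). *)
Definition metric_separable {Y : Type} (d : Y -> Y -> R) : Prop :=
  exists s : nat -> option Y,
    forall y eps, 0 < eps -> exists k y', s k = Some y' /\ d y y' < eps.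

Definition zero_dimensional {Y : Type} (d : Y -> Y -> R) : Prop :=
  forall (U : Y -> Prop) x, metric_open d U -> U x ->
    exists C : Y -> Prop, metric_open d C /\ closed_in (metric_open d) C /\
      C x /\ (forall y, C y -> U y).

Definition Pi02_complete {X : Type} (opnX : (X -> Prop) -> Prop) (A : X -> Prop) : Prop :=
  Pi02 opnX A /\
  forall (Y : Type) (d : Y -> Y -> R),
    is_metric d -> metric_complete d -> metric_separable d -> zero_dimensional d ->
    forall B : Y -> Prop, Pi02 (metric_open d) B ->
      exists f : Y -> X, continuous (metric_open d) opnX f /\
        (forall y, A (f y) <-> B y).

Definition periodic_quotient (n : nat) (N : Gn n) : Prop :=
  forall g : Fn n, exists k : nat, (1 <= k)%nat /\ proj1_sig N (fn_pow n g k) = true.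

(* Main.v *)
Require Import Defs.
From Stdlib Require Import Reals List Bool Arith.
From Stdlib Require Import Lia Lra Classical ClassicalEpsilon Eqdep_dec Cantor.
Import ListNotations.

(** The reduction uses groups [G_x] of automorphisms of the rooted ternary tree, one for each
    binary sequence [x].  They are generated by the rooted 3-cycle [a] and by
    [b_x = (b_{x'}, a, a^e)], where [x'] is the shift of [x], and [e = -1] if [x 0] is true,
    [e = 0] otherwise (the recursions of Gupta-Sidki and of Fabrykowski-Gupta respectively).
    - A word with [m] letters [b] either is a conjugate of a power of [b] times a power of [a],
      or has all its sections of smaller [b]-length; hence the first [m] bits of [x] decide
      whether it is trivial in [G_x], and [x |-> G_x] is continuous.
    - If a word [w] moves the first level, the sections of [w^3] have at most the [b]-length of
      [w], and their exponent sum in [a] is [(1 + e)] times the exponent sum of [w] in [b].  So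
      when [x] has infinitely many ones one eventually meets words fixing the first level, and
      induction on the [b]-length shows that [G_x] is periodic.
    - If [x] is eventually zero, then [a b] has infinite order in [G_{x'}] for some iterated
      shift [x'], and every element of [G_{x'}] is a section of an element of [G_x].
    A Pi02 subset of a zero-dimensional separable metric space is the preimage of the set of
    sequences with infinitely many ones under a continuous map. *)

Local Open Scope nat_scope.

(** * Automorphisms of the ternary tree *)

Inductive t3 := z0 | z1 | z2.

Definition add3 (a b : t3) : t3 :=
  match a, b with
  | z0, c | c, z0 => c
  | z1, z1 => z2
  | z2, z2 => z1
  | _, _ => z0
  end.

Definition opp3 (a : t3) : t3 :=
  match a with z0 => z0 | z1 => z2 | z2 => z1 end.

Ltac bash3 :=
  repeat match goal with a : t3 |- _ => destruct a end; simpl in *; try congruence; auto.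

Lemma add3_assoc a b c : add3 a (add3 b c) = add3 (add3 a b) c.
Proof. bash3. Qed.

Lemma add3_0_r a : add3 a z0 = a.
Proof. bash3. Qed.

Definition seq2 := nat -> bool.
Definition shift (x : seq2) : seq2 := fun k => x (S k).

(** The letters stand for the powers [a^s] and [b^j] with exponents modulo 3. Trivial powers are
    allowed, so that every section of a letter [B] is again a single letter. *)
Inductive gen := A (s : t3) | B (j : t3).
Definition word := list gen.

Definition apow (s : t3) (v : list t3) : list t3 :=
  match v with [] => [] | c :: v' => add3 c s :: v' end.

Fixpoint bpow (x : seq2) (j : t3) (v : list t3) : list t3 :=
  match v with
  | [] => []
  | c :: v' =>
      c :: match c with
           | z0 => bpow (shift x) j v'
           | z1 => apow j v'
           | z2 => apow (if x 0 then opp3 j else z0) v'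
           end
  end.

Definition actg (x : seq2) (l : gen) : list t3 -> list t3 :=
  match l with A s => apow s | B j => bpow x j end.

Fixpoint act (x : seq2) (w : word) (v : list t3) : list t3 :=
  match w with [] => v | l :: w' => actg x l (act x w' v) end.

Lemma apow_add s t v : apow s (apow t v) = apow (add3 s t) v.
Proof. destruct v; simpl; f_equal; bash3. Qed.

Lemma apow_0 v : apow z0 v = v.
Proof. destruct v; simpl; f_equal; bash3. Qed.

Lemma bpow_add x i j v : bpow x i (bpow x j v) = bpow x (add3 i j) v.
Proof.
  revert x; induction v as [|c v IH]; intro x; simpl; auto.
  f_equal; destruct c; auto using apow_add.
  rewrite apow_add; f_equal; destruct (x 0); bash3.
Qed.

Lemma bpow_0 x v : bpow x z0 v = v.
Proof.
  revert x; induction v as [|c v IH]; intro x; simpl; auto.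
  f_equal; destruct c; auto using apow_0.
  destruct (x 0); apply apow_0.
Qed.

Lemma act_app x u w v : act x (u ++ w) v = act x u (act x w v).
Proof. induction u as [|l u IH]; simpl; auto. now rewrite IH. Qed.

Lemma act_nil x w : act x w [] = [].
Proof.
  induction w as [|l w IH]; simpl; auto.
  rewrite IH; destruct l; auto.
Qed.

(** * Exponent sums, [b]-length and sections of words *)

Fixpoint asum (w : word) : t3 :=
  match w with
  | [] => z0
  | A s :: w' => add3 s (asum w')
  | B _ :: w' => asum w'
  end.

Fixpoint bsum (w : word) : t3 :=
  match w with
  | [] => z0
  | A _ :: w' => bsum w'
  | B j :: w' => add3 j (bsum w')
  end.

Fixpoint blen (w : word) : nat :=
  match w with
  | [] => 0
  | A _ :: w' => blen w'
  | B _ :: w' => S (blen w')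
  end.

(** Words act from the right: when [B j] is reached, [w'] has already moved the vertex [c] to
    [add3 c (asum w')], and the section of [b^j] is taken there. *)
Fixpoint sec (x : seq2) (w : word) (c : t3) : word :=
  match w with
  | [] => []
  | A _ :: w' => sec x w' c
  | B j :: w' =>
      match add3 c (asum w') with
      | z0 => B j
      | z1 => A j
      | z2 => A (if x 0 then opp3 j else z0)
      end :: sec x w' c
  end.

Lemma act_cons x w c v :
  act x w (c :: v) = add3 c (asum w) :: act (shift x) (sec x w c) v.
Proof.
  induction w as [|[s|j] w IH]; simpl.
  - f_equal; bash3.
  - rewrite IH; simpl; f_equal.
    generalize (asum w); intro; bash3.
  - rewrite IH; simpl; f_equal.
    destruct (add3 c (asum w)); reflexivity.
Qed.

Lemma asum_app u w : asum (u ++ w) = add3 (asum u) (asum w).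
Proof.
  induction u as [|[s|j] u IH]; simpl; auto. now rewrite IH, add3_assoc.
Qed.

Lemma bsum_app u w : bsum (u ++ w) = add3 (bsum u) (bsum w).
Proof.
  induction u as [|[s|j] u IH]; simpl; auto. now rewrite IH, add3_assoc.
Qed.

Lemma blen_app u w : blen (u ++ w) = blen u + blen w.
Proof. induction u as [|[s|j] u IH]; simpl; auto. Qed.

Lemma sec_app x u w c : sec x (u ++ w) c = sec x u (add3 c (asum w)) ++ sec x w c.
Proof.
  induction u as [|[s|j] u IH]; simpl; auto.
  rewrite IH, asum_app; simpl; repeat f_equal.
  replace (add3 c (add3 (asum u) (asum w))) with (add3 (add3 c (asum w)) (asum u));
    [reflexivity|].
  generalize (asum u), (asum w); intros; bash3.
Qed.

(** As [c] varies, a given [B] meets each of the three vertices once, and only at [z0] does it leave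
    a [B]. *)
Lemma blen_sec x w :
  blen (sec x w z0) + blen (sec x w z1) + blen (sec x w z2) = blen w.
Proof.
  induction w as [|[s|j] w IH]; simpl; auto.
  destruct (asum w); simpl; lia.
Qed.

Lemma blen_sec_le x w c : blen (sec x w c) <= blen w.
Proof. generalize (blen_sec x w); destruct c; lia. Qed.

(** Each [B j] contributes [a^j] to one section and [a^(e j)] to another, hence [(1 + e) j] in
    total. *)
Lemma asum_sec x w :
  add3 (asum (sec x w z0)) (add3 (asum (sec x w z1)) (asum (sec x w z2)))
  = if x 0 then z0 else bsum w.
Proof.
  induction w as [|[s|j] w IH]; simpl; auto.
  - now destruct (x 0).
  - revert IH; generalize (bsum w).
    destruct (asum w); simpl;
      generalize (asum (sec x w z0)), (asum (sec x w z1)), (asum (sec x w z2));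
      intros; destruct (x 0); bash3.
Qed.

Lemma bsum_sec x w :
  add3 (bsum (sec x w z0)) (add3 (bsum (sec x w z1)) (bsum (sec x w z2))) = bsum w.
Proof.
  induction w as [|[s|j] w IH]; simpl; auto.
  rewrite <- IH.
  destruct (asum w); simpl;
    generalize (bsum (sec x w z0)), (bsum (sec x w z1)), (bsum (sec x w z2));
    intros; bash3.
Qed.

(* Here all the letters [B] of [w] contribute to the same coordinate, so [w] is a conjugate of
   a power of [b] times a power of [a]. *)
Lemma act_concentrated x w c :
  blen (sec x w c) = blen w ->
  forall v, act x w v = apow (add3 (asum w) c) (bpow x (bsum w) (apow (opp3 c) v)).
Proof.
  induction w as [|[s|j] w IH]; simpl; intros H v.
  - rewrite bpow_0, apow_add. symmetry. replace (add3 c (opp3 c)) with z0 by bash3.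
    apply apow_0.
  - rewrite IH by assumption. now rewrite apow_add, add3_assoc.
  - pose proof (blen_sec_le x w c) as Hle.
    destruct (add3 c (asum w)) eqn:E; simpl in H; try lia.
    rewrite IH by lia.
    replace (add3 (asum w) c) with z0
      by (revert E; generalize (asum w); intros; bash3).
    now rewrite !apow_0, bpow_add.
Qed.

(** * The word problem *)

Definition concentrated (x : seq2) (w : word) : Prop :=
  exists c, blen (sec x w c) = blen w.

Lemma not_concentrated_lt x w c : ~ concentrated x w -> blen (sec x w c) < blen w.
Proof.
  intro H. pose proof (blen_sec_le x w c).
  assert (blen (sec x w c) <> blen w) by (intro; apply H; now exists c). lia.
Qed.

Definition trivial (x : seq2) (w : word) : Prop := forall v, act x w v = v.

Lemma trivial_asum x w : trivial x w -> asum w = z0.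
Proof.
  intro H. specialize (H [z0]). rewrite act_cons in H. simpl in H. congruence.
Qed.

Lemma trivial_iff_sec x w :
  trivial x w <-> asum w = z0 /\ forall c, trivial (shift x) (sec x w c).
Proof.
  split.
  - intro H; split; [exact (trivial_asum x w H)|].
    intros c v. specialize (H (c :: v)). rewrite act_cons in H. congruence.
  - intros [Ha H] [|c v]; [apply act_nil|].
    now rewrite act_cons, Ha, add3_0_r, H.
Qed.

Lemma trivial_concentrated x w :
  concentrated x w -> (trivial x w <-> asum w = z0 /\ bsum w = z0).
Proof.
  intros [c Hc]. pose proof (act_concentrated x w c Hc) as E. split.
  - intro H. pose proof (trivial_asum x w H) as Ha. split; auto.
    (* The conjugating power of [a] takes the first letter to [z1], below which [b^j] acts as [a^j];
       so [bsum w] shows on the second letter. *)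
    specialize (H [add3 c z1; z0]). rewrite E, Ha in H.
    destruct (bsum w), c; simpl in H; congruence.
  - intros [Ha Hb] v. rewrite E, Ha, Hb, bpow_0, apow_add.
    replace (add3 (add3 z0 c) (opp3 c)) with z0 by bash3. apply apow_0.
Qed.

Lemma sec_ext x x' w c : x 0 = x' 0 -> sec x w c = sec x' w c.
Proof. intro H; induction w as [|[s|j] w IH]; simpl; auto. now rewrite H, IH. Qed.

(** Each passage to sections uses one bit of [x] and removes at least one [B], until the word is
    concentrated; it is then decided by [asum] and [bsum], which do not involve [x]. *)
Lemma trivial_finitely_determined m x x' w :
  blen w <= m -> (forall k, k < m -> x k = x' k) -> trivial x w -> trivial x' w.
Proof.
  revert x x' w; induction m as [m IH] using lt_wf_ind; intros x x' w Hm Hx H.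
  destruct (classic (concentrated x w)) as [C|C].
  - assert (C' : concentrated x' w).
    (* For [m = 0] no bit is known to agree, but a word without [B] is concentrated at any
       vertex. *)
    { destruct m as [|m].
      - exists z0. pose proof (blen_sec_le x' w z0). lia.
      - destruct C as [c Hc]; exists c. rewrite <- (sec_ext x); auto.
        apply Hx; lia. }
    apply trivial_concentrated in H; auto. now apply trivial_concentrated.
  - pose proof (fun c => not_concentrated_lt x w c C) as L.
    assert (m <> 0) by (specialize (L z0); lia).
    apply trivial_iff_sec in H; destruct H as [Ha H].
    apply trivial_iff_sec; split; auto. intro c.
    rewrite <- (sec_ext x) by (apply Hx; lia).
    apply (IH (m - 1)) with (x := shift x); auto; try lia.
    + specialize (L c); lia.
    + intros k Hk; apply Hx; lia.
Qed.

(** * Torsion and non-torsion elements *)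

Definition torsion (x : seq2) (w : word) : Prop :=
  exists k, 1 <= k /\ forall v, Nat.iter k (act x w) v = v.

Lemma iter_mul_id {T} (f : T -> T) k m :
  (forall v, Nat.iter k f v = v) -> forall v, Nat.iter (m * k) f v = v.
Proof.
  intro H; induction m as [|m IH]; intro v; simpl; auto.
  rewrite Nat.iter_add, IH; apply H.
Qed.

Lemma iter_act_nil x w k : Nat.iter k (act x w) [] = [].
Proof. induction k as [|k IH]; simpl; auto. rewrite IH; apply act_nil. Qed.

Lemma iter_act_cons x w k c v : asum w = z0 ->
  Nat.iter k (act x w) (c :: v) = c :: Nat.iter k (act (shift x) (sec x w c)) v.
Proof.
  intro H; induction k as [|k IH]; simpl; auto.
  now rewrite IH, act_cons, H, add3_0_r.
Qed.

Lemma torsion_of_sec x w :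
  asum w = z0 -> (forall c, torsion (shift x) (sec x w c)) -> torsion x w.
Proof.
  intros Ha H.
  destruct (H z0) as [k0 [P0 H0]], (H z1) as [k1 [P1 H1]], (H z2) as [k2 [P2 H2]].
  exists (k0 * k1 * k2); split; [nia|].
  intros [|c v]; [apply iter_act_nil|].
  rewrite iter_act_cons by assumption; f_equal; destruct c.
  - replace (k0 * k1 * k2) with (k1 * k2 * k0) by lia; now apply iter_mul_id.
  - replace (k0 * k1 * k2) with (k0 * k2 * k1) by lia; now apply iter_mul_id.
  - now apply iter_mul_id.
Qed.

Definition cube (w : word) : word := w ++ w ++ w.

Lemma iter_cube x w k v : Nat.iter k (act x (cube w)) v = Nat.iter (k * 3) (act x w) v.
Proof.
  induction k as [|k IH]; simpl; auto.
  unfold cube at 1; now rewrite !act_app, IH.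
Qed.

Lemma asum_cube w : asum (cube w) = z0.
Proof. unfold cube; rewrite !asum_app; destruct (asum w); auto. Qed.

Lemma sec_cube x w c :
  sec x (cube w) c
  = sec x w (add3 c (add3 (asum w) (asum w))) ++ sec x w (add3 c (asum w)) ++ sec x w c.
Proof. unfold cube; now rewrite !sec_app, asum_app. Qed.

(** The three factors of [sec_cube] are taken at the three distinct vertices, so a section of the
    cube is the product of all sections of [w] in some order. The next two lemmas rest on the same
    fact. *)
Lemma blen_sec_cube x w c : asum w <> z0 -> blen (sec x (cube w) c) = blen w.
Proof.
  intro H; rewrite sec_cube, !blen_app, <- (blen_sec x w).
  destruct (asum w), c; simpl; try congruence; lia.
Qed.

Lemma asum_sec_cube x w c :
  asum w <> z0 -> asum (sec x (cube w) c) = if x 0 then z0 else bsum w.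
Proof.
  intro H; rewrite sec_cube, !asum_app, <- asum_sec.
  destruct (asum w), c; simpl; try congruence;
    generalize (asum (sec x w z0)), (asum (sec x w z1)), (asum (sec x w z2));
    intros; bash3.
Qed.

Lemma bsum_sec_cube x w c : asum w <> z0 -> bsum (sec x (cube w) c) = bsum w.
Proof.
  intro H; rewrite sec_cube, !bsum_app, <- (bsum_sec x w).
  destruct (asum w), c; simpl; try congruence;
    generalize (bsum (sec x w z0)), (bsum (sec x w z1)), (bsum (sec x w z2));
    intros; bash3.
Qed.

Lemma torsion_of_sec_cube x w :
  (forall c, torsion (shift x) (sec x (cube w) c)) -> torsion x w.
Proof.
  intro H; apply torsion_of_sec in H; [|apply asum_cube].
  destruct H as [k [P H]]; exists (k * 3); split; [lia|].
  intro v; now rewrite <- iter_cube.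
Qed.

(** Such a word is a conjugate of a power of [b], and [b] has order 3. *)
Lemma torsion_concentrated x w : asum w = z0 -> concentrated x w -> torsion x w.
Proof.
  intros Ha [c Hc]. exists 3; split; [lia|]. intro v; simpl.
  rewrite !(act_concentrated x w c Hc), !apow_add, Ha.
  replace (add3 (opp3 c) (add3 z0 c)) with z0 by bash3.
  rewrite !apow_0, !bpow_add.
  replace (add3 (add3 (bsum w) (bsum w)) (bsum w)) with z0 by (destruct (bsum w); auto).
  rewrite bpow_0, apow_add.
  replace (add3 (add3 z0 c) (opp3 c)) with z0 by bash3. apply apow_0.
Qed.

Definition infinitely_many_ones (x : seq2) : Prop :=
  forall m, exists k, m <= k /\ x k = true.

Lemma infinitely_many_ones_shift x :
  infinitely_many_ones x -> infinitely_many_ones (shift x).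
Proof.
  intros H m. destruct (H (S m)) as [[|k] [L E]]; [lia|].
  exists k; split; auto; lia.
Qed.

Lemma all_torsion x w : infinitely_many_ones x -> torsion x w.
Proof.
  remember (blen w) as m eqn:Hm.
  revert x w Hm; induction m as [m IH] using lt_wf_ind; intros x w Hm Hx.
  assert (fix_case : forall x w, infinitely_many_ones x -> m = blen w ->
            asum w = z0 -> torsion x w).
  { clear x w Hm Hx; intros x w Hx Hm Ha.
    destruct (classic (concentrated x w)) as [C|C].
    - now apply torsion_concentrated.
    - apply torsion_of_sec; auto. intro c.
      apply (IH (blen (sec x w c))); auto using infinitely_many_ones_shift.
      rewrite Hm; now apply not_concentrated_lt. }
  (* The inner induction is on the position [k] of a one of [x]. Sections of the cube keep the
     length while the shift brings this one nearer; for [k = 0] they fix the first level. *)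
  destruct (Hx 0) as [k [_ Hk]].
  revert x w Hm Hx Hk; induction k as [|k IHk]; intros x w Hm Hx Hk;
    (assert (D : asum w = z0 \/ asum w <> z0) by (destruct (asum w); auto; right; easy));
    (destruct D as [Ha|Ha]; [now apply fix_case|]);
    apply torsion_of_sec_cube; intro c.
  - apply fix_case; auto using infinitely_many_ones_shift.
    + now rewrite blen_sec_cube.
    + now rewrite asum_sec_cube, Hk.
  - apply IHk; auto using infinitely_many_ones_shift.
    now rewrite blen_sec_cube.
Qed.

(** A word with nonzero [asum] permutes the first level as a 3-cycle. *)
Lemma iter_id_multiple_of_3 x w k :
  asum w <> z0 -> (forall v, Nat.iter k (act x w) v = v) -> exists q, k = q * 3.
Proof.
  intros Ha H. exists (k / 3).
  pose proof (Nat.div_mod k 3 ltac:(lia)) as E.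
  pose proof (Nat.mod_upper_bound k 3 ltac:(lia)) as Lt.
  specialize (H [z0]). rewrite E in H.
  (* The multiple of 3 acts first and fixes the first letter, so the remainder has to fix it as
     well. *)
  replace (3 * (k / 3) + k mod 3) with (k mod 3 + k / 3 * 3) in H by lia.
  rewrite Nat.iter_add, <- iter_cube, iter_act_cons in H by apply asum_cube.
  destruct (k mod 3) as [|[|[|r]]]; simpl in H; try lia;
    rewrite ?act_cons in H; destruct (asum w); simpl in H; congruence.
Qed.

(** Infinite descent: an exponent killing [w] is [q * 3], and [q] kills the section of the cube,
    whose sums in [a] and in [b] both equal [bsum w] because [e = 0] at every level. *)
Lemma not_torsion_zero x w :
  (forall k, x k = false) -> asum w <> z0 -> bsum w <> z0 -> ~ torsion x w.
Proof.
  intros Hx Ha Hb [k [P H]].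
  revert x w Hx Ha Hb P H; induction k as [k IH] using lt_wf_ind; intros.
  destruct (iter_id_multiple_of_3 x w k Ha H) as [q ->].
  apply (IH q) with (x := shift x) (w := sec x (cube w) z0); try lia.
  - intro; apply Hx.
  - now rewrite asum_sec_cube, Hx.
  - now rewrite bsum_sec_cube.
  - intro v. specialize (H (z0 :: v)).
    rewrite <- iter_cube, iter_act_cons in H by apply asum_cube. congruence.
Qed.

(* [lift_word w] fixes the vertex [0] and has section [w] there. *)
Definition lift_word (w : word) : word :=
  flat_map (fun l => match l with A s => [A z2; B s; A z1] | B j => [B j] end) w.

(** At [z0] the section of [b^j] is [b^j] itself, and conjugating [b^s] by [a] brings there its
    section [a^s] from [z1]. *)
Lemma act_lift_word x w v : act x (lift_word w) (z0 :: v) = z0 :: act (shift x) w v.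
Proof.
  induction w as [|[s|j] w IH]; simpl; auto;
    rewrite IH; reflexivity.
Qed.

Lemma torsion_lift_word x w : torsion x (lift_word w) -> torsion (shift x) w.
Proof.
  intros [k [P H]]; exists k; split; auto. intro v.
  assert (E : Nat.iter k (act x (lift_word w)) (z0 :: v)
              = z0 :: Nat.iter k (act (shift x) w) v).
  { clear; induction k as [|k IH]; simpl; auto. now rewrite IH, act_lift_word. }
  rewrite H in E; congruence.
Qed.

Lemma exists_not_torsion x : ~ infinitely_many_ones x -> exists w, ~ torsion x w.
Proof.
  intro H. apply not_all_ex_not in H; destruct H as [m H].
  assert (E : forall k, m <= k -> x k = false).
  { intros k Hk; destruct (x k) eqn:F; auto. exfalso; eauto. }
  clear H; revert x E; induction m as [|m IH]; intros x E.
  - exists [A z1; B z1]. apply not_torsion_zero; simpl; try congruence.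
    intro; apply E; lia.
  - destruct (IH (shift x)) as [w Hw].
    + intros k Hk; apply E; lia.
    + exists (lift_word w); intro T; apply Hw; now apply torsion_lift_word.
Qed.

(** * The normal subgroups of the free group *)

(** The first two free generators go to [a] and [b], all others to the identity. *)
Definition gen_of_letter (l : letter) : gen :=
  let s := if snd l then z2 else z1 in
  match fst l with 0 => A s | 1 => B s | _ => A z0 end.

Definition word_of (w : list letter) : word := map gen_of_letter w.

Lemma word_of_app u w : word_of (u ++ w) = word_of u ++ word_of w.
Proof. apply map_app. Qed.

Lemma actg_cancels x a b v :
  cancels a b = true -> actg x (gen_of_letter a) (actg x (gen_of_letter b) v) = v.
Proof.
  destruct a as [i s], b as [j t]; unfold cancels; simpl; intro H.
  apply andb_true_iff in H; destruct H as [E F]; apply Nat.eqb_eq in E; subst j.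
  destruct i as [|[|i]], s, t; try discriminate; simpl;
    rewrite ?apow_add, ?bpow_add; simpl; auto using apow_0, bpow_0.
Qed.

Lemma act_reduce x w v : act x (word_of (reduce w)) v = act x (word_of w) v.
Proof.
  induction w as [|a w IH]; simpl; auto.
  rewrite <- IH.
  destruct (reduce w) as [|b r]; simpl; auto.
  destruct (cancels a b) eqn:C; simpl; auto.
  symmetry; now apply actg_cancels.
Qed.

Lemma act_inv x w v :
  act x (word_of (rev (map inv_letter w))) (act x (word_of w) v) = v.
Proof.
  revert v; induction w as [|a w IH]; intro v; simpl; auto.
  rewrite word_of_app, act_app; simpl.
  rewrite actg_cancels; [apply IH|].
  unfold cancels, inv_letter; simpl; rewrite Nat.eqb_refl; now destruct (snd a).
Qed.

Lemma act_inv_r x w v :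
  act x (word_of w) (act x (word_of (rev (map inv_letter w))) v) = v.
Proof.
  rewrite <- (act_inv x (rev (map inv_letter w)) v) at 2.
  f_equal. rewrite map_rev, rev_involutive, map_map.
  rewrite (map_ext _ (fun a => a)), map_id; auto.
  intros [i b]; unfold inv_letter; simpl; now rewrite negb_involutive.
Qed.

Definition acts (n : nat) (x : seq2) (g : Fn n) : list t3 -> list t3 :=
  act x (word_of (proj1_sig g)).

Lemma acts_mul n x g h v : acts n x (fn_mul n g h) v = acts n x g (acts n x h v).
Proof. unfold acts; simpl; now rewrite act_reduce, word_of_app, act_app. Qed.

Lemma acts_pow n x g k v : acts n x (fn_pow n g k) v = Nat.iter k (acts n x g) v.
Proof. induction k as [|k IH]; simpl; auto. now rewrite acts_mul, IH. Qed.

Definition kernel (n : nat) (x : seq2) (g : Fn n) : bool :=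
  if excluded_middle_informative (forall v, acts n x g v = v) then true else false.

Lemma kernel_true n x g : kernel n x g = true <-> forall v, acts n x g v = v.
Proof.
  unfold kernel; destruct excluded_middle_informative; split; auto; discriminate.
Qed.

Lemma kernel_normal n x : is_normal_subgroup n (kernel n x).
Proof.
  assert (I : forall g v, acts n x (fn_inv n g) (acts n x g v) = v).
  { intros; unfold acts; simpl; rewrite act_reduce; apply act_inv. }
  assert (I' : forall g v, acts n x g (acts n x (fn_inv n g) v) = v).
  { intros; unfold acts; simpl; rewrite act_reduce; apply act_inv_r. }
  repeat split; intros; rewrite !kernel_true in *; intro v.
  - reflexivity.
  - now rewrite acts_mul, H0, H.
  - rewrite <- (H v) at 1; apply I.
  - rewrite !acts_mul, H; apply I'.
Qed.

Definition kernel_Gn (n : nat) (x : seq2) : Gn n := exist _ (kernel n x) (kernel_normal n x).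

Lemma kernel_finitely_determined n g :
  exists m, forall x x', (forall k, k < m -> x k = x' k) -> kernel n x g = kernel n x' g.
Proof.
  exists (blen (word_of (proj1_sig g))); intros x x' H.
  apply eq_true_iff_eq; rewrite !kernel_true; split;
    apply (trivial_finitely_determined (blen (word_of (proj1_sig g)))); auto.
  intros; symmetry; auto.
Qed.

Definition letters_of_gen (l : gen) : list letter :=
  match l with
  | A z0 | B z0 => []
  | A z1 => [(0, false)]
  | A z2 => [(0, true)]
  | B z1 => [(1, false)]
  | B z2 => [(1, true)]
  end.

Lemma act_letters_of_gen x w v : act x (word_of (flat_map letters_of_gen w)) v = act x w v.
Proof.
  induction w as [|l w IH]; simpl; auto.
  rewrite word_of_app, act_app, IH.
  destruct l as [s|s], s; simpl; auto; symmetry; auto using apow_0, bpow_0.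
Qed.

(** Here [1 < n] provides free generators for both [a] and [b]. *)
Lemma bounded_letters_of_gen n w : 1 < n -> Defs.bounded n (flat_map letters_of_gen w) = true.
Proof.
  intro H; induction w as [|l w IH]; simpl; auto.
  apply bounded_app; auto.
  destruct n as [|[|n]]; try lia. destruct l as [s|s], s; reflexivity.
Qed.

Lemma periodic_kernel n x : 1 < n ->
  (periodic_quotient n (kernel_Gn n x) <-> infinitely_many_ones x).
Proof.
  intro Hn; split.
  - intro P; apply NNPP; intro H.
    destruct (exists_not_torsion x H) as [w Hw]; apply Hw.
    destruct (P (exist _ _ (wf_reduce n _ (bounded_letters_of_gen n w Hn)))) as [k [Pk Hk]].
    exists k; split; auto. intro v. simpl in Hk; rewrite kernel_true in Hk.
    rewrite <- (Hk v) at 2. rewrite acts_pow.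
    clear; induction k as [|k IH]; simpl; auto.
    rewrite IH; unfold acts; simpl. now rewrite act_reduce, act_letters_of_gen.
  - intros H g. destruct (all_torsion x (word_of (proj1_sig g)) H) as [k [P K]].
    exists k; split; auto. simpl; apply kernel_true. intro v; rewrite acts_pow; apply K.
Qed.

(** * Descriptive complexity of periodicity *)

Fixpoint code (w : list letter) : nat :=
  match w with
  | [] => 0
  | (i, b) :: w' => S (to_nat (to_nat (i, Nat.b2n b), code w'))
  end.

Lemma code_inj u w : code u = code w -> u = w.
Proof.
  revert w; induction u as [|[i b] u IH]; intros [|[j c] w] H; try discriminate; auto.
  cbn [code] in H. apply Nat.succ_inj, to_nat_inj in H.
  assert (E1 := f_equal fst H); assert (E2 := f_equal snd H); cbn [fst snd] in *.
  apply to_nat_inj in E1. rewrite (IH w E2). destruct b, c; simpl in E1; congruence.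
Qed.

Lemma Fn_eq n (g h : Fn n) : proj1_sig g = proj1_sig h -> g = h.
Proof.
  destruct g as [u p], h as [w q]; simpl; intro E; subst w.
  f_equal; apply UIP_dec, bool_dec.
Qed.

Lemma periodic_Pi02 n : Pi02 (Gn_open n) (fun N : Gn n => periodic_quotient n N).
Proof.
  (* The complement is a union over the countably many [g], indexed by their codes; an index coding
     no element gives the empty set. *)
  exists (fun k N => exists g : Fn n, code (proj1_sig g) = k /\
            forall j, 1 <= j -> proj1_sig N (fn_pow n g j) <> true).
  split.
  - intro k. exists (fun N => forall g : Fn n, code (proj1_sig g) = k ->
                exists j, 1 <= j /\ N (fn_pow n g j) = true).
    split.
    + intros N H. destruct (classic (exists g : Fn n, code (proj1_sig g) = k)) as [[g C]|E].
      * destruct (H g C) as [j [P E]]. exists [fn_pow n g j].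
        intros N' H' g' C'. rewrite <- C in C'. apply code_inj, Fn_eq in C'; subst g'.
        exists j; split; auto. rewrite H'; simpl; auto.
      * exists []. intros N' _ g C. exfalso; eauto.
    + intro N; split.
      * intros H g C. apply NNPP; intro H'; apply H.
        exists g; split; auto. intros j P E; eauto.
      * intros H [g [C H']]. destruct (H g C) as [j [P E]]. exact (H' j P E).
  - intro N; split.
    + intro H; apply not_all_ex_not in H; destruct H as [g H].
      exists (code (proj1_sig g)), g; split; auto. intros j P E; eauto.
    + intros [k [g [_ H]]] P. destruct (P g) as [j [L E]]. exact (H j L E).
Qed.

(** * Clopen sets in zero-dimensional separable metric spaces *)

Local Open Scope R_scope.

Lemma choice_function {S T : Type} (P : S -> T -> Prop) :
  (forall s, exists t, P s t) -> exists f, forall s, P s (f s).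
Proof.
  intro H. exists (fun s => proj1_sig (constructive_indefinite_description _ (H s))).
  intro s. exact (proj2_sig (constructive_indefinite_description _ (H s))).
Qed.

Section ZeroDimensional.

Context {Y : Type} (d : Y -> Y -> R).

Definition locally_constant {T : Type} (f : Y -> T) : Prop :=
  forall y, exists eps, 0 < eps /\ forall y', d y y' < eps -> f y' = f y.

Lemma locally_constant_const {T} (t : T) : locally_constant (fun _ => t).
Proof. intro y; exists 1; split; auto; lra. Qed.

Lemma locally_constant_bind {S T} (f : Y -> S) (g : S -> Y -> T) :
  locally_constant f -> (forall s, locally_constant (g s)) ->
  locally_constant (fun y => g (f y) y).
Proof.
  intros Hf Hg y. destruct (Hf y) as [e1 [P1 H1]], (Hg (f y) y) as [e2 [P2 H2]].
  exists (Rmin e1 e2); split; [now apply Rmin_pos|].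
  intros y' H. rewrite H1, H2; auto.
  - apply Rlt_le_trans with (1 := H), Rmin_r.
  - apply Rlt_le_trans with (1 := H), Rmin_l.
Qed.

Lemma locally_constant_existsb {T} (c : T -> Y -> bool) (l : list T) :
  (forall t, locally_constant (c t)) ->
  locally_constant (fun y => existsb (fun t => c t y) l).
Proof.
  intro H; induction l as [|t l IH]; simpl; [apply locally_constant_const|].
  apply (locally_constant_bind (c t) (fun b y => b || existsb (fun t => c t y) l)); auto.
  intro b. apply (locally_constant_bind _ (fun b' _ => b || b') IH).
  intro; apply locally_constant_const.
Qed.

Lemma locally_constant_near (x : Y -> seq2) y m :
  (forall k, locally_constant (fun y => x y k)) ->
  exists eps, 0 < eps /\
    forall y', d y y' < eps -> forall k, (k < m)%nat -> x y' k = x y k.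
Proof.
  intro H; induction m as [|m [e1 [P1 H1]]].
  - exists 1; split; [lra|]. intros; lia.
  - destruct (H m y) as [e2 [P2 H2]].
    exists (Rmin e1 e2); split; [now apply Rmin_pos|].
    intros y' D k Hk.
    pose proof (Rmin_l e1 e2); pose proof (Rmin_r e1 e2).
    destruct (Nat.eq_dec k m) as [->|]; [apply H2; lra|].
    apply H1; [lra|lia].
Qed.

Lemma locally_constant_clopen (C : Y -> Prop) :
  metric_open d C -> closed_in (metric_open d) C ->
  locally_constant (fun y => if excluded_middle_informative (C y) then true else false).
Proof.
  intros O F y. destruct (excluded_middle_informative (C y)) as [H|H].
  - destruct (O y H) as [e [P E]]; exists e; split; auto.
    intros y' D; specialize (E y' D). now destruct excluded_middle_informative.
  - destruct (F y H) as [e [P E]]; exists e; split; auto.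
    intros y' D; specialize (E y' D). now destruct excluded_middle_informative.
Qed.

(** The index [j] codes a point of the dense sequence and a radius [1 / (m + 1)]; whenever some
    clopen subset of [U] contains that ball, one such set is chosen, and otherwise the empty set. *)
Lemma metric_open_union_of_clopen (U : Y -> Prop) :
  is_metric d -> metric_separable d -> zero_dimensional d -> metric_open d U ->
  exists c : nat -> Y -> bool,
    (forall j, locally_constant (c j)) /\ (forall y, U y <-> exists j, c j y = true).
Proof.
  intros [_ [_ [Sym Tri]]] [s Hs] Z O.
  pose (adm := fun (j : nat) (C : Y -> Prop) =>
    metric_open d C /\ closed_in (metric_open d) C /\ (forall y, C y -> U y) /\
    exists y0, s (fst (of_nat j)) = Some y0 /\
      forall y, d y0 y < / INR (S (snd (of_nat j))) -> C y).
  pose (ok := fun j (c : Y -> bool) =>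
    locally_constant c /\ (forall y, c y = true -> U y) /\
    ((exists C, adm j C) -> exists y0, s (fst (of_nat j)) = Some y0 /\
      forall y, d y0 y < / INR (S (snd (of_nat j))) -> c y = true)).
  assert (E : forall j, exists c, ok j c).
  { intro j. destruct (classic (exists C, adm j C)) as [[C [O1 [O2 [I [y0 [S0 B0]]]]]]|N].
    - exists (fun y => if excluded_middle_informative (C y) then true else false).
      split; [now apply locally_constant_clopen|split].
      + intros y; destruct excluded_middle_informative; auto; discriminate.
      + intros _; exists y0; split; auto. intros y D; specialize (B0 y D).
        now destruct excluded_middle_informative.
    - exists (fun _ => false). split; [apply locally_constant_const|split].
      + discriminate.
      + intro H; contradiction. }
  apply choice_function in E; destruct E as [c Hc].
  exists c; split; [apply Hc|].
  intro y; split.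
  - intro Uy. destruct (Z U y O Uy) as [C [O1 [O2 [Cy I]]]].
    destruct (O1 y Cy) as [e [P Be]].
    (* Half of [e], since a point of the ball around [y0] is reached from [y] in two steps shorter
       than this radius. *)
    destruct (archimed_cor1 (e / 2)) as [m [Hm Pm]]; [lra|].
    destruct m as [|m]; [lia|].
    destruct (Hs y (/ INR (S m))) as [k [y0 [S0 D0]]].
    { apply Rinv_0_lt_compat, lt_0_INR; lia. }
    exists (to_nat (k, m)).
    destruct (Hc (to_nat (k, m))) as [_ [_ H]].
    destruct H as [y1 [S1 B1]].
    + exists C; split; [auto|split; [auto|split; [auto|]]].
      exists y0. rewrite cancel_of_to; cbn [fst snd]. split; auto.
      intros z Dz. apply Be. specialize (Tri y y0 z). lra.
    + rewrite cancel_of_to in *; cbn [fst snd] in *.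
      apply B1. rewrite Sym. congruence.
  - intros [j H]. now apply (Hc j).
Qed.

End ZeroDimensional.

(* The state is the index [k] of the first set [U_k], the union of the [c k j], in which the
   point has not been located yet; it increases when the stage [t] reaches a [j] with
   [c k j] true, and these events are the ones of the sequence. *)
Section Reduction.

Context {Y : Type} (c : nat -> nat -> Y -> bool).

(** Stage [t] inspects only finitely many indices, which keeps the outcome locally constant. *)
Definition hit (t k : nat) (y : Y) : bool := existsb (fun j => c k j y) (seq 0 t).

Fixpoint state (t : nat) (y : Y) : nat :=
  match t with
  | 0%nat => 0%nat
  | S t' => if hit t' (state t' y) y then S (state t' y) else state t' y
  end.

Definition progress (y : Y) : seq2 := fun t => hit t (state t y) y.

Lemma locally_constant_state d t :
  (forall k j, locally_constant d (c k j)) -> locally_constant d (state t).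
Proof.
  intro H; induction t as [|t IH]; simpl; [apply locally_constant_const|].
  apply (locally_constant_bind d (state t) (fun k y => if hit t k y then S k else k)); auto.
  intro k. apply (locally_constant_bind d (hit t k) (fun b _ => if b then S k else k)).
  - now apply locally_constant_existsb.
  - intro; apply locally_constant_const.
Qed.

Lemma locally_constant_progress d t :
  (forall k j, locally_constant d (c k j)) -> locally_constant d (fun y => progress y t).
Proof.
  intro H. apply (locally_constant_bind d (state t) (hit t)).
  - now apply locally_constant_state.
  - intro k; now apply locally_constant_existsb.
Qed.

Local Open Scope nat_scope.

Lemma state_mono s t y : s <= t -> state s y <= state t y.
Proof.
  induction 1 as [|t _ IH]; auto. simpl; destruct hit; lia.
Qed.

Lemma hit_true t k y : hit t k y = true <-> exists j, j < t /\ c k j y = true.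
Proof.
  unfold hit; rewrite existsb_exists; split; intros [j [I H]]; exists j; split; auto.
  - apply in_seq in I; lia.
  - apply in_seq; lia.
Qed.

(** Infinitely many events drive the state past every [k], and it leaves [k] only by a hit in [U_k].
    With finitely many events the state freezes at some [k], which is impossible if [y] lies in
    [U_k]. *)
Lemma progress_infinite y :
  infinitely_many_ones (progress y) <-> forall k, exists j, c k j y = true.
Proof.
  split.
  - intro H.
    assert (L : forall k, exists t, k < state t y).
    { induction k as [|k [t Ht]].
      - destruct (H 0) as [t [_ E]]. exists (S t); simpl.
        unfold progress in E; rewrite E; lia.
      - destruct (H t) as [t' [Lt E]]. exists (S t'); simpl.
        unfold progress in E; rewrite E. pose proof (state_mono t t' y Lt); lia. }
    intro k; destruct (L k) as [t Ht].
    induction t as [|t IH]; simpl in Ht; [lia|].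
    destruct (hit t (state t y) y) eqn:E; auto.
    destruct (Nat.eq_dec k (state t y)) as [->|]; [|apply IH; lia].
    apply hit_true in E; destruct E as [j [_ E]]; eauto.
  - intros H m. apply NNPP; intro N.
    assert (C : forall t, m <= t -> progress y t = false).
    { intros t Lt; destruct (progress y t) eqn:E; auto. exfalso; eauto. }
    assert (St : forall t, m <= t -> state t y = state m y).
    { induction 1 as [|t Lt IH]; auto. simpl.
      specialize (C t Lt); unfold progress in C; now rewrite C. }
    destruct (H (state m y)) as [j Hj].
    (* This stage comes after the freezing stage [m] and late enough to inspect [j]. *)
    specialize (C (S (m + j)) ltac:(lia)). unfold progress in C.
    rewrite St in C by lia.
    assert (E : hit (S (m + j)) (state m y) y = true).
    { apply hit_true; exists j; split; auto; lia. }
    congruence.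
Qed.

End Reduction.

(** * Continuity of the reduction and completeness *)

Lemma kernel_continuous n {Y : Type} (d : Y -> Y -> R) (x : Y -> seq2) :
  (forall k, locally_constant d (fun y => x y k)) ->
  continuous (metric_open d) (Gn_open n) (fun y => kernel_Gn n (x y)).
Proof.
  intros H U [V [OV UV]] y Uy.
  apply UV, OV in Uy; destruct Uy as [F HF]; simpl in HF.
  assert (E : exists eps, 0 < eps /\ forall y', d y y' < eps ->
            forall g, In g F -> kernel n (x y') g = kernel n (x y) g).
  { clear HF; induction F as [|g F [e1 [P1 H1]]].
    - exists 1; split; [lra|]. intros y' _ g [].
    - destruct (kernel_finitely_determined n g) as [m Hm].
      destruct (locally_constant_near d x y m H) as [e2 [P2 H2]].
      exists (Rmin e1 e2); split; [now apply Rmin_pos|].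
      intros y' D. pose proof (Rmin_l e1 e2); pose proof (Rmin_r e1 e2).
      intros g' [<-|I].
      + apply Hm, H2; lra.
      + apply H1; auto; lra. }
  destruct E as [e [P E]]; exists e; split; auto.
  intros y' D; apply UV, HF; simpl; auto.
Qed.

Theorem mainTheorem2 (n : nat) (hn : (1 < n)%nat) :
  Pi02_complete (Gn_open n) (fun N : Gn n => periodic_quotient n N).
Proof.
  split; [apply periodic_Pi02|].
  intros Y d M _ Sep Z B [F [HF HB]].
  (* [B] is the intersection of the open complements of the [F k]; these serve as the sets [U_k] of
     the reduction. *)
  pose proof (fun k => metric_open_union_of_clopen d _ M Sep Z (HF k)) as E.
  apply choice_function in E; destruct E as [c Hc].
  exists (fun y => kernel_Gn n (progress c y)); split.
  - apply kernel_continuous. intro t; apply locally_constant_progress.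
    intros k; apply Hc.
  - intro y. rewrite periodic_kernel, progress_infinite by assumption. split.
    + intro H; apply NNPP; intro N; apply HB in N; destruct N as [k N].
      now apply (Hc k) in H.
    + intros By k. apply (Hc k). intro N. assert (~ B y) by (apply HB; eauto). auto.
Qed.
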